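(* Let $f:\mathbb{R}^n\to\mathbb{R}$ be convex and differentiable, let $g:\mathbb{R}^n\to\mathbb{R}$, and set $\zeta=f+g$. Assume: (i) $\zeta$ is coercive, i.e. $\zeta(\mathbf{x})\to\infty$ as $\|\mathbf{x}\|_2\to\infty$; (ii) $\zeta$ is bounded below; (iii) $g$ is proper, lower semicontinuous, finite-valued, weakly convex with modulus $\sigma_g>0$, and directionally differentiable; (iv) $\nabla f$ is Lipschitz continuous with constant $\mathrm{Lip}_{\nabla f}>0$, i.e. $\|\nabla f(\mathbf{x})-\nabla f(\mathbf{y})\|_2\le \mathrm{Lip}_{\nabla f}\|\mathbf{x}-\mathbf{y}\|_2$ for all $\mathbf{x},\mathbf{y}\in\mathbb{R}^n$. If $\rho>\max\{\sigma_g,\sqrt{2}\,\mathrm{Lip}_{\nabla f}\}$, then the sequence of iterates $\{(\mathbf{x}^t,\mathbf{z}^t,\mathbf{v}^t)\}_{t=1}^\infty$ generated by ADMM with parameter $\rho$ (from any initial point $(\mathbf{x}^0,\mathbf{z}^0,\mathbf{v}^0)$) has a subsequence converging to a limit $(\mathbf{x}^*,\mathbf{z}^*,\mathbf{v}^* )$ such that $\mathbf{x}^*$ is a d-stationary point of the problem $\min_{\mathbf{x}\in\mathbb{R}^n}\zeta(\mathbf{x})$.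
   Context: Weak convexity: $g$ is weakly convex with modulus $\sigma_g>0$ if $g(\mathbf{x})+\frac{\sigma_g}{2}\|\mathbf{x}\|_2^2$ is convex. Directional derivative: $h'(\mathbf{x};\mathbf{d})=\lim_{\tau\downarrow 0}\frac{h(\mathbf{x}+\tau\mathbf{d})-h(\mathbf{x})}{\tau}$; $h$ is directionally differentiable if this limit exists for all $\mathbf{x},\mathbf{d}$. d-stationary point: $\mathbf{x}^*\in\mathbb{R}^n$ is d-stationary (directional stationary) for $\min_{\mathbf{x}}\zeta(\mathbf{x})$ if $\zeta'(\mathbf{x}^*;\mathbf{x}-\mathbf{x}^* )\ge 0$ for all $\mathbf{x}\in\mathbb{R}^n$. Augmented Lagrangian, for $\rho>0$: $\mathcal{L}(\mathbf{x},\mathbf{z};\mathbf{v})=f(\mathbf{z})+g(\mathbf{x})+\rho\langle\mathbf{v},\mathbf{x}-\mathbf{z}\rangle+\frac{\rho}{2}\|\mathbf{x}-\mathbf{z}\|_2^2$ for $\mathbf{x},\mathbf{z},\mathbf{v}\in\mathbb{R}^n$. ADMM iterations: given $(\mathbf{x}^0,\mathbf{z}^0,\mathbf{v}^0)$, for $t=0,1,2,\dots$, $\mathbf{x}^{t+1}\in\arg\min_{\mathbf{x}}\mathcal{L}(\mathbf{x},\mathbf{z}^t;\mathbf{v}^t)$, $\mathbf{z}^{t+1}\in\arg\min_{\mathbf{z}}\mathcal{L}(\mathbf{x}^{t+1},\mathbf{z};\mathbf{v}^t)$, $\mathbf{v}^{t+1}=\mathbf{v}^t+\mathbf{x}^{t+1}-\mathbf{z}^{t+1}$.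 *)

(* Defs.v *)
From mathcomp Require Import all_boot all_order all_algebra.
From mathcomp Require Import all_classical all_reals all_analysis.

Set Implicit Arguments.
Unset Strict Implicit.
Unset Printing Implicit Defensive.

Import Order.TTheory GRing.Theory Num.Theory.
Import numFieldNormedType.Exports.

Local Open Scope classical_set_scope.
Local Open Scope ring_scope.

(* The library norm `|x| on 'rV[R]_n is the sup norm, so the Euclidean
   structure of R^n is defined here; the library topology on 'rV[R]_n, used for
   limits, semicontinuity and differentiability, is the usual one. *)
Definition dot (R : realType) (n : nat) (x y : 'rV[R]_n) : R :=
  \sum_(i < n) x 0 i * y 0 i.

Definition norm2 (R : realType) (n : nat) (x : 'rV[R]_n) : R :=
  Num.sqrt (dot x x).

Definition grad (R : realType) (n : nat) (f : 'rV[R]_n -> R) (x : 'rV[R]_n) :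
    'rV[R]_n :=
  \row_(i < n) 'D_(delta_mx 0 i) f x.

Definition convex (R : realType) (n : nat) (h : 'rV[R]_n -> R) : Prop :=
  convex_function setT h.

Definition weakly_convex (R : realType) (n : nat) (sigma : R)
    (g : 'rV[R]_n -> R) : Prop :=
  convex (fun x => g x + sigma / 2 * norm2 x ^+ 2).

Definition coercive (R : realType) (n : nat) (h : 'rV[R]_n -> R) : Prop :=
  forall A : R, exists r : R, forall x, r <= norm2 x -> A <= h x.

Definition dquot (R : realType) (n : nat) (h : 'rV[R]_n -> R)
    (x d : 'rV[R]_n) (tau : R) : R :=
  (h (x + tau *: d) - h x) / tau.

(* 0^'+ is the filter of right neighbourhoods of 0, with 0 excluded. The value
   of dirderiv is only meaningful when has_dirderiv holds. *)
Definition has_dirderiv (R : realType) (n : nat) (h : 'rV[R]_n -> R)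
    (x d : 'rV[R]_n) : Prop :=
  cvg (dquot h x d tau @[tau --> 0^'+]).

Definition dirderiv (R : realType) (n : nat) (h : 'rV[R]_n -> R)
    (x d : 'rV[R]_n) : R :=
  lim (dquot h x d tau @[tau --> 0^'+]).

Definition directionally_differentiable (R : realType) (n : nat)
    (h : 'rV[R]_n -> R) : Prop :=
  forall x d, has_dirderiv h x d.

Definition d_stationary (R : realType) (n : nat) (h : 'rV[R]_n -> R)
    (xs : 'rV[R]_n) : Prop :=
  forall x, has_dirderiv h xs (x - xs) /\ 0 <= dirderiv h xs (x - xs).

Definition argmin (R : realType) (T : Type) (h : T -> R) : set T :=
  [set x | forall y, h x <= h y].

Definition aug_lagrangian (R : realType) (n : nat) (f g : 'rV[R]_n -> R)
    (rho : R) (x z v : 'rV[R]_n) : R :=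
  f z + g x + rho * dot v (x - z) + rho / 2 * norm2 (x - z) ^+ 2.

Definition admm_iterates (R : realType) (n : nat) (f g : 'rV[R]_n -> R)
    (rho : R) (x z v : nat -> 'rV[R]_n) : Prop :=
  forall t : nat,
    [/\ argmin (fun y => aug_lagrangian f g rho y (z t) (v t)) (x t.+1),
        argmin (fun y => aug_lagrangian f g rho (x t.+1) y (v t)) (z t.+1)
      & v t.+1 = v t + x t.+1 - z t.+1].

(* Main.v *)
Require Import Defs.
From mathcomp Require Import all_boot all_order all_algebra.
From mathcomp Require Import all_classical all_reals all_analysis.
From mathcomp Require Import ring lra.

Set Implicit Arguments.
Unset Strict Implicit.
Unset Printing Implicit Defensive.

Import Order.TTheory GRing.Theory Num.Theory.
Import numFieldNormedType.Exports.

Local Open Scope classical_set_scope.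
Local Open Scope ring_scope.

(** Write [zeta = f + g] and let [merit t] be the augmented Lagrangian at the
    iterate of index [t + 1].

    Completing the square, the [x]-step is the proximal step of [g] at [z - v]
    and the [z]-step is the proximal step of [f] at [x + v] ([is_prox]). The
    first-order condition of the latter reads [grad f z = rho v]
    ([admm_grad]), so from the first iterate on the multiplier is a function of
    [z], and the Lipschitz bound gives [rho |dv| <= Lip |dz|] for the increments
    [dv] and [dz] between consecutive iterates.

    The merit function decreases ([merit_decrease]): the [x]-step does not
    increase the Lagrangian, the [z]-step lowers it by at least
    [rho / 2 |dz|^2] because [f] is convex, and the multiplier update raises it
    by [rho |dv|^2 <= Lip^2 / rho |dz|^2]. The balance is negative exactly when
    [rho > sqrt 2 Lip]. The descent lemma for [f], together with
    [rho v = grad f z], shows that the merit dominates [zeta x] ([merit_ge]).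
    Hence [zeta x] stays below the initial merit, and the [x]-iterates are
    bounded by coercivity; and the merit converges, which forces [dz -> 0], then
    [dv -> 0], that is [x - z -> 0].

    Extract a subsequence along which [x -> xs]. Then [z -> xs] and
    [v -> grad f xs / rho], also one index earlier since the increments vanish.
    Minimality in a proximal step survives the limit as [g] is lower
    semicontinuous ([is_prox_closed]), so [xs] is a proximal point of [g] at
    [xs - vs]. Its first-order condition bounds the directional derivative of
    [g] at [xs] along [d] below by [- dot (grad f xs) d]
    ([is_prox_dirderiv_ge]), and adding the derivative of [f] gives a
    nonnegative directional derivative of [zeta]. *)

(** * The Euclidean inner product and the topology of row vectors *)

Section Dot.
Context {R : realType} {n : nat}.
Implicit Types (x y z : 'rV[R]_n) (a : R).

Lemma dotC x y : dot x y = dot y x.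
Proof. by apply: eq_bigr => i _; rewrite mulrC. Qed.

Lemma dotDl x y z : dot (x + y) z = dot x z + dot y z.
Proof.
by rewrite /dot -big_split; apply: eq_bigr => i _ /=; rewrite mxE mulrDl.
Qed.

Lemma dotZl a x y : dot (a *: x) y = a * dot x y.
Proof. by rewrite /dot mulr_sumr; apply: eq_bigr => i _; rewrite mxE mulrA. Qed.

Lemma dotNl x y : dot (- x) y = - dot x y.
Proof. by rewrite -scaleN1r dotZl mulN1r. Qed.

Lemma dotDr x y z : dot x (y + z) = dot x y + dot x z.
Proof. by rewrite dotC dotDl !(dotC x). Qed.

Lemma dotZr a x y : dot x (a *: y) = a * dot x y.
Proof. by rewrite dotC dotZl dotC. Qed.

Lemma dotNr x y : dot x (- y) = - dot x y.
Proof. by rewrite dotC dotNl dotC. Qed.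

Definition dotE := (dotDl, dotDr, dotNl, dotNr, dotZl, dotZr).

Lemma dot_ge0 x : 0 <= dot x x.
Proof. by apply: sumr_ge0 => i _; rewrite -expr2 sqr_ge0. Qed.

Lemma sqr_norm2 x : norm2 x ^+ 2 = dot x x.
Proof. by rewrite sqr_sqrtr ?dot_ge0. Qed.

(** The left-hand side is the sup norm, which carries the topology; this is the
    bridge from Euclidean estimates to limits. *)
Lemma norm_le_norm2 x : `|x| <= norm2 x.
Proof.
rewrite [leLHS]/Num.norm /= mx_normrE; apply: bigmax_le => [|[i j] _ /=].
  exact: sqrtr_ge0.
rewrite -sqrtr_sqr ler_wsqrtr// (ord1 i) /dot (bigD1 j)//= -expr2 lerDl.
by apply: sumr_ge0 => k _; rewrite -expr2 sqr_ge0.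
Qed.

Lemma dot_eq0 x : dot x x = 0 -> x = 0.
Proof.
move=> x0; apply/eqP; rewrite -normr_le0 (le_trans (norm_le_norm2 x))//.
by rewrite /norm2 x0 sqrtr0.
Qed.

Lemma cvg_dot {T : Type} {F : set_system T} {FF : Filter F}
    (u w : T -> 'rV[R]_n) x y :
  u @ F --> x -> w @ F --> y -> dot (u t) (w t) @[t --> F] --> dot x y.
Proof.
move=> ux wy; apply: cvg_big => [|i _]; first exact: add_continuous.
apply: cvgM.
  exact: (cvg_comp _ _ ux (@coord_continuous _ _ _ 0 i x)).
exact: (cvg_comp _ _ wy (@coord_continuous _ _ _ 0 i y)).
Qed.

Lemma dot_cvg0 {T : Type} {F : set_system T} {FF : Filter F}
    (u : T -> 'rV[R]_n) :
  dot (u t) (u t) @[t --> F] --> 0 -> u @ F --> (0 : 'rV[R]_n).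
Proof.
move=> u0; apply/norm_cvg0P/cvgrPdist_lt => e e0; near=> t.
rewrite sub0r normrN normr_id (le_lt_trans (norm_le_norm2 _)) //.
rewrite -(ltr_pXn2r (n := 2)) ?nnegrE ?sqrtr_ge0 ?(ltW e0)// sqr_norm2.
by near: t; apply: (cvgr_lt 0 u0); rewrite exprn_gt0.
Unshelve. all: by end_near. Qed.

Lemma dot_le_cvg0 {T : Type} {F : set_system T} {FF : Filter F} (C : R)
    (u w : T -> 'rV[R]_n) :
  (forall t, dot (w t) (w t) <= C * dot (u t) (u t)) ->
  u @ F --> (0 : 'rV[R]_n) -> w @ F --> (0 : 'rV[R]_n).
Proof.
move=> wu u0; apply: dot_cvg0.
have Cu0 : (C * dot (u t) (u t)) @[t --> F] --> (0 : R).
  rewrite -[X in _ --> X](mulr0 C).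
  have <- : dot (0 : 'rV[R]_n) 0 = 0 by rewrite -(scale0r 0) dotZl mul0r.
  by apply: cvgM; [exact: cvg_cst | exact: cvg_dot].
apply: (squeeze_cvgr _ (cvg_cst 0) Cu0); near=> t.
by rewrite dot_ge0 wu.
Unshelve. all: by end_near. Qed.

End Dot.

Lemma increasing_seq_cvg_infty (phi : nat -> nat) :
  increasing_seq phi -> phi @ \oo --> \oo.
Proof.
move=> /increasing_seqP phi_lt; have phi_ge k : (k <= phi k)%N.
  by elim: k => // k /leq_ltn_trans; apply; exact: phi_lt.
move=> A [N _ NA]; exists N => // k /= Nk; apply: NA.
exact: leq_trans (phi_ge k).
Qed.

Section BolzanoWeierstrass.
Context {R : realType} {n : nat}.

(** Compactness yields a cluster point [a] of [u], hence [0] is a cluster value of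
    the real sequence of distances to [a], for which subsequences can be
    extracted. *)
Lemma bounded_cvg_subsequence (u : nat -> 'rV[R]_n) (r : R) :
  (forall k, `|u k| <= r) ->
  exists2 phi : nat -> nat, increasing_seq phi
    & exists a : 'rV[R]_n, u \o phi @ \oo --> a.
Proof.
move=> ur.
have Kcpt : compact [set x : 'rV[R]_n | `|x| <= r].
  apply: bounded_closed_compact.
    exists r; split; first exact: num_real.
    by move=> s rs x /= /le_trans; apply; exact: ltW.
  by apply: closed_comp (@closed_le R r) => x _; exact: norm_continuous.
have [|a [_ ua]] := Kcpt (u @ \oo) _; first by exists 0%N => // k _; exact: ur.
have /cluster_eventually_cvg[phi phi_incr uphi] :
    cluster ((fun k => `|u k - a|) @ \oo) 0.
  apply/cluster_eventuallyP => e N e0.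
  have uN : (u @ \oo) (u @` [set k | (N <= k)%N]).
    by exists N => // k /= Nk; exists k.
  have [_ [[k Nk <-]]] := ua _ _ uN (nbhsx_ballx a _ e0).
  rewrite -ball_normE /= => /ltW ake.
  by exists k => //; rewrite sub0r normrN normr_id distrC.
exists phi => //; exists a; apply/subr_cvg0/norm_cvg0P; exact: uphi.
Qed.

End BolzanoWeierstrass.

(** * Proximal points *)

Section Prox.
Context {R : realType} {n : nat}.
Implicit Types (h : 'rV[R]_n -> R) (c : R) (w p y : 'rV[R]_n).

(** [p] is a proximal point of [h] at [w] with parameter [1 / c]. *)
Definition is_prox c h w p :=
  argmin (fun y => h y + c / 2 * dot (y - w) (y - w)) p.

Lemma is_prox_shift c h w p (l : 'rV[R]_n -> R) (b : R) :
  (forall y, l y = h y + c / 2 * dot (y - w) (y - w) + b) ->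
  argmin l p -> is_prox c h w p.
Proof. by move=> lE pmin y; have := pmin y; rewrite !lE lerD2r. Qed.

(** The quadratic term makes the objective strongly convex with modulus [c], so it
    grows at least quadratically away from its minimiser. Comparing [p] with the
    point at parameter [t] of the segment from [p] to [y] gives the claim with
    the last term multiplied by [1 - t]; let [t] tend to [0]. *)
Lemma convex_prox_le c h w p y : convex h -> is_prox c h w p ->
  h p + c / 2 * dot (p - w) (p - w) + c / 2 * dot (y - p) (y - p)
    <= h y + c / 2 * dot (y - w) (y - w).
Proof.
move=> hcvx pmin.
pose A := h y + c / 2 * dot (y - w) (y - w)
  - (h p + c / 2 * dot (p - w) (p - w)).
pose B := c / 2 * dot (y - p) (y - p).
have A0 : 0 <= A by rewrite subr_ge0; exact: pmin.
have key t : 0 < t -> t <= 1 -> (1 - t) * B <= A.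
  move=> t0 t1; have t0' := ltW t0.
  have hm : h (t *: y + (1 - t) *: p) <= t * h y + (1 - t) * h p.
    by apply: (hcvx (Itv01 t0' t1)); rewrite inE.
  have := le_trans (pmin (t *: y + (1 - t) *: p)) (lerD hm (lexx _)).
  rewrite /A /B !dotE !(dotC w) !(dotC p y) => le_m.
  by rewrite -(ler_pM2l t0); lra.
suff : B <= A by rewrite /A /B; lra.
rewrite leNgt; apply/negP => AB.
have B0 : 0 < B := le_lt_trans A0 AB.
(* If [A < B], any [t < (B - A) / B] contradicts [key]; take half of it. *)
have B2 : 0 < 2 * B by rewrite mulr_gt0.
have t_gt0 : 0 < (B - A) / (2 * B) by rewrite divr_gt0// subr_gt0.
have t_le1 : (B - A) / (2 * B) <= 1 by rewrite ler_pdivrMr//; lra.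
have := key _ t_gt0 t_le1.
have -> : (1 - (B - A) / (2 * B)) * B = (A + B) / 2 by field; rewrite gt_eqF.
lra.
Qed.

Lemma is_prox_ge c h w p y : is_prox c h w p ->
  c * dot (w - p) (y - p) - c / 2 * dot (y - p) (y - p) <= h y - h p.
Proof. by move=> /(_ y); rewrite !dotE !(dotC w) !(dotC p y); lra. Qed.

(** Dividing the quadratic lower bound at [p + tau d] by [tau] leaves only the
    linear term when [tau] tends to [0]. *)
Lemma is_prox_dirderiv_ge c h w p d l : is_prox c h w p ->
  dquot h p d tau @[tau --> 0^'+] --> l -> c * dot (w - p) d <= l.
Proof.
move=> pmin hl.
have lin : (c * dot (w - p) d - tau * (c / 2 * dot d d)) @[tau --> 0^'+]
    --> c * dot (w - p) d - 0 * (c / 2 * dot d d).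
  apply: cvgB; first exact: cvg_cst.
  by apply: cvgM; [exact: cvg_at_right_filter | exact: cvg_cst].
rewrite mul0r subr0 in lin.
apply: (ler_cvg_to lin hl); near=> tau.
have tau0 : 0 < tau by near: tau; exact: nbhs_right_gt.
rewrite /dquot ler_pdivlMr//.
have := is_prox_ge (p + tau *: d) pmin.
by rewrite (addrC p) addrK (addrC (tau *: d)) !dotZr !dotZl; lra.
Unshelve. all: by end_near. Qed.

(** [h] is only lower semicontinuous, but that suffices: the value of [h] at the
    limit is to be bounded above by the competitor's value, and each [p k] already
    satisfies this bound. *)
Lemma is_prox_closed c h (w p : nat -> 'rV[R]_n) ws ps :
  lower_semicontinuous (EFin \o h) ->
  w @ \oo --> ws -> p @ \oo --> ps ->
  (forall k, is_prox c h (w k) (p k)) -> is_prox c h ws ps.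
Proof.
move=> hlsc wws pps pmin y.
pose q (u v : 'rV[R]_n) : R := c / 2 * dot (u - v) (u - v).
have qcvg (a : nat -> 'rV[R]_n) (as_ : 'rV[R]_n) : a @ \oo --> as_ ->
    q (a k) (w k) @[k --> \oo] --> q as_ ws.
  by move=> aas; apply: cvgM; [exact: cvg_cst | apply: cvg_dot; exact: cvgB].
rewrite -/(q ps ws) -/(q y ws) -lerBrDr.
apply/ler_addgt0Pr => e e0; rewrite -lerBlDr.
have [|V Vps Vb] := hlsc ps (h ps - e); first by rewrite lte_fin gtrBl.
have rhs_cvg : (h y + q y (w k) - q (p k) (w k)) @[k --> \oo]
    --> h y + q y ws - q ps ws.
  apply: cvgB; last exact: qcvg.
  by apply: cvgD; [exact: cvg_cst | apply: qcvg; exact: cvg_cst].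
apply: (cvgr_to_ge rhs_cvg); near=> k.
have pV : V (p k) by near: k; exact: pps.
have := Vb _ pV; rewrite lte_fin => /ltW/le_trans; apply.
by rewrite lerBrDr; exact: pmin.
Unshelve. all: by end_near. Qed.

End Prox.

(** * Gradients and the descent lemma *)

Section Gradient.
Context {R : realType} {n : nat}.
Implicit Types (f : 'rV[R]_n -> R) (x z d : 'rV[R]_n).

Lemma derive_grad f x d : differentiable f x -> 'D_d f x = dot (grad f x) d.
Proof.
move=> fx; rewrite deriveE// [in LHS](row_sum_delta d) linear_sum.
by apply: eq_bigr => i _; rewrite linearZ mxE deriveE// mulrC.
Qed.

Lemma dquot_cvg_grad f x d : differentiable f x ->
  dquot f x d tau @[tau --> 0^'+] --> dot (grad f x) d.
Proof.
move=> fx; rewrite -derive_grad//; apply: cvg_dnbhs_at_right.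
have -> : dquot f x d
    = fun tau => tau^-1 *: ((f \o shift x) (tau *: d) - f x).
  by apply/funext => tau; rewrite /dquot /= (addrC (tau *: d)) mulrC.
exact: (@diff_derivable _ _ _ f x d fx).
Qed.

Lemma is_derive_line f x d (t : R) : (forall y, differentiable f y) ->
  is_derive t 1 (fun s => f (x + s *: d)) (dot (grad f (x + t *: d)) d).
Proof.
move=> fd.
have shiftE : (fun k : R => k^-1 *:
      (((fun s => f (x + s *: d)) \o shift t) (k *: 1) - f (x + t *: d)))
    = (fun k => k^-1 *: ((f \o shift (x + t *: d)) (k *: d) - f (x + t *: d))).
  apply/funext => k /=; congr (_ *: (f _ - _)).
  by rewrite [k *: 1]mulr1 scalerDl addrCA.
split; first by rewrite /derivable shiftE; exact: diff_derivable.
by rewrite /derive shiftE -/(derive _ _ _) derive_grad.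
Qed.

Lemma grad_lip_dot f L x y : 0 < L ->
  (forall y y', norm2 (grad f y - grad f y') <= L * norm2 (y - y')) ->
  dot (grad f x - grad f y) (grad f x - grad f y) <= L ^+ 2 * dot (x - y) (x - y).
Proof.
move=> L0 fL; rewrite -!sqr_norm2 -exprMn ler_pXn2r ?nnegrE ?sqrtr_ge0//.
by rewrite mulr_ge0 ?sqrtr_ge0// ltW.
Qed.

(** The defect of the upper bound along the segment [x + s d] vanishes at [s = 0]
    and has a nonpositive derivative, because the gradient moves by at most
    [L s |d|]. The constant [L / 2] matters: [merit_ge] needs it to be at most
    [rho / 2]. *)
Lemma descent f (L : R) x d : (forall y, differentiable f y) -> 0 < L ->
  (forall y y', norm2 (grad f y - grad f y') <= L * norm2 (y - y')) ->
  f (x + d) <= f x + dot (grad f x) d + L / 2 * dot d d.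
Proof.
move=> fd L0 fL.
pose phi (s : R) := f (x + s *: d) - s * dot (grad f x) d
  - L / 2 * dot d d * s ^+ 2.
pose dphi (s : R) := dot (grad f (x + s *: d)) d - dot (grad f x) d
  - L * s * dot d d.
have dphiE (s : R) : is_derive s 1 phi (dphi s).
  have := is_derive_line x d s fd => fs.
  apply: is_derive_eq.
  by rewrite /dphi /GRing.scale /=; field.
have [|s s01] := @MVT _ phi dphi 0 1 ltr01 (fun s _ => dphiE s).
  by apply: derivable_within_continuous => s _; have := dphiE s.
rewrite /phi !scale1r !scale0r addr0 subr0 mulr1.
suff : dphi s <= 0 by lra.
have s0 : 0 < s by move: s01; rewrite in_itv /= => /andP[].
have -> : dphi s = dot (grad f (x + s *: d) - grad f x) d - L * s * dot d d.
  by rewrite dotDl dotNl.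
(* Young's inequality for the gradient increment and [d], with the weight [L * s]
   that makes both halves of the bound equal *)
have := dot_ge0 (grad f (x + s *: d) - grad f x - (L * s) *: d).
have := grad_lip_dot (x + s *: d) x L0 fL; rewrite (addrC x) addrK.
move: (grad f _ - _) => G; rewrite !dotE (dotC d G) => GL Y.
by rewrite subr_le0 -(ler_pM2l (mulr_gt0 L0 s0)); lra.
Qed.

Lemma grad_cvg f L (u : nat -> 'rV[R]_n) a : 0 < L ->
  (forall y y', norm2 (grad f y - grad f y') <= L * norm2 (y - y')) ->
  u @ \oo --> a -> grad f (u k) @[k --> \oo] --> grad f a.
Proof.
move=> L0 fL ua; apply/subr_cvg0.
apply: (dot_le_cvg0 (fun k => grad_lip_dot (u k) a L0 fL)).
exact/subr_cvg0.
Qed.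

(** The one-sided first-order condition along [d = - (grad f p - c *: (w - p))]
    says that this residual has nonpositive square norm. *)
Lemma is_prox_grad c f w p : differentiable f p -> is_prox c f w p ->
  grad f p = c *: (w - p).
Proof.
move=> fp pmin; apply/eqP; rewrite -subr_eq0; apply/eqP/dot_eq0.
set r := grad f p - _; apply/eqP; rewrite eq_le dot_ge0 andbT.
have := is_prox_dirderiv_ge pmin (dquot_cvg_grad (d := - r) fp).
have -> : dot r r = dot (grad f p) r - c * dot (w - p) r.
  by rewrite {1}/r dotDl dotNl dotZl.
by rewrite !dotNr; lra.
Qed.

End Gradient.

(** * The merit function along the iterations *)

Section ADMM.
Context {R : realType} {n : nat} (f g : 'rV[R]_n -> R) (rho : R).

(** Completing the square turns each primal step into a proximal step: the last
    summand is constant in the variable being minimised. *)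
Lemma aug_lagrangianE_x x z v : aug_lagrangian f g rho x z v
  = g x + rho / 2 * dot (x - (z - v)) (x - (z - v)) + (f z - rho / 2 * dot v v).
Proof.
rewrite /aug_lagrangian sqr_norm2 !dotE !(dotC v) !(dotC z x) ?(dotC v z).
by field.
Qed.

Lemma aug_lagrangianE_z x z v : aug_lagrangian f g rho x z v
  = f z + rho / 2 * dot (z - (x + v)) (z - (x + v)) + (g x - rho / 2 * dot v v).
Proof.
rewrite /aug_lagrangian sqr_norm2 !dotE !(dotC v) !(dotC z x) ?(dotC v z).
by field.
Qed.

Lemma aug_lagrangian_dual x z v v' : aug_lagrangian f g rho x z v'
  = aug_lagrangian f g rho x z v + rho * dot (v' - v) (x - z).
Proof. by rewrite /aug_lagrangian dotDl dotNl; ring. Qed.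

Context (x z v : nat -> 'rV[R]_n) (admm : admm_iterates f g rho x z v).

Lemma admm_x_prox t : is_prox rho g (z t - v t) (x t.+1).
Proof.
have [+ _ _] := admm t; apply: is_prox_shift => y; exact: aug_lagrangianE_x.
Qed.

Lemma admm_z_prox t : is_prox rho f (x t.+1 + v t) (z t.+1).
Proof.
have [_ + _] := admm t; apply: is_prox_shift => y; exact: aug_lagrangianE_z.
Qed.

Lemma admm_residual t : x t.+1 - z t.+1 = v t.+1 - v t.
Proof. by have [_ _ ->] := admm t; rewrite addrAC (addrC (v t)) addrK. Qed.

Context (Lip : R) (f_convex : convex f)
  (f_diff : forall y, differentiable f y) (Lip_gt0 : 0 < Lip)
  (grad_lip : forall y y' : 'rV[R]_n,
    norm2 (grad f y - grad f y') <= Lip * norm2 (y - y'))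
  (rho_gt0 : 0 < rho) (rho_sqr : 2 * Lip ^+ 2 < rho ^+ 2).

(** Optimality of the [z]-step at [w = x + v] gives [rho (x + v - z)], which is
    [rho] times the updated multiplier. It says nothing about index [0], where
    [z] and [v] are arbitrary; this is why the analysis starts at index [1]. *)
Lemma admm_grad t : grad f (z t.+1) = rho *: v t.+1.
Proof.
rewrite (is_prox_grad (f_diff _) (admm_z_prox t)).
by have [_ _ ->] := admm t; rewrite (addrC (x _)).
Qed.

(** The index is shifted so that [admm_grad] applies at every term. *)
Definition merit t := aug_lagrangian f g rho (x t.+1) (z t.+1) (v t.+1).

Lemma dual_step_le t :
  rho ^+ 2 * dot (v t.+2 - v t.+1) (v t.+2 - v t.+1)
    <= Lip ^+ 2 * dot (z t.+2 - z t.+1) (z t.+2 - z t.+1).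
Proof.
rewrite expr2 -mulrA -dotZl -dotZr scalerBr -!admm_grad.
exact: grad_lip_dot.
Qed.

Lemma merit_decrease t : merit t.+1 <= merit t
  - (rho / 2 - Lip ^+ 2 / rho) * dot (z t.+2 - z t.+1) (z t.+2 - z t.+1).
Proof.
have xstep : aug_lagrangian f g rho (x t.+2) (z t.+1) (v t.+1) <= merit t.
  by have [+ _ _] := admm t.+1; exact.
have zstep := convex_prox_le (z t.+1) f_convex (admm_z_prox t.+1).
rewrite -(opprB (z t.+2) (z t.+1)) dotNl dotNr opprK in zstep.
rewrite aug_lagrangianE_z in xstep.
have vstep : rho * dot (v t.+2 - v t.+1) (v t.+2 - v t.+1)
    <= Lip ^+ 2 / rho * dot (z t.+2 - z t.+1) (z t.+2 - z t.+1).
  rewrite -(ler_pM2l rho_gt0) mulrA -expr2 (le_trans (dual_step_le t))//.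
  by rewrite mulrA mulrCA divff ?mulr1// gt_eqF.
rewrite {1}/merit (aug_lagrangian_dual _ _ (v t.+1)) aug_lagrangianE_z.
rewrite admm_residual; lra.
Qed.

Lemma merit_ge t : f (x t.+1) + g (x t.+1) <= merit t.
Proof.
have := descent (z t.+1) (x t.+1 - z t.+1) f_diff Lip_gt0 grad_lip.
rewrite /merit /aug_lagrangian sqr_norm2 admm_grad dotZl addrC subrK => fx.
have Lip_rho : Lip <= rho.
  rewrite -(ler_pXn2r (n := 2)) ?nnegrE ?(ltW Lip_gt0) ?(ltW rho_gt0)//.
  by have := sqr_ge0 Lip; move: rho_sqr; lra.
have := ler_wpM2r (dot_ge0 (x t.+1 - z t.+1)) Lip_rho.
lra.
Qed.

Context (zeta_bounded : has_lbound (range (f \+ g))).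

(** The net rate of decrease; its positivity is what the factor [sqrt 2] in the
    bound on [rho] is for. *)
Let kappa := rho / 2 - Lip ^+ 2 / rho.

Let kappa_gt0 : 0 < kappa.
Proof. by rewrite subr_gt0 ltr_pdivrMr// mulrAC ltr_pdivlMr// -expr2 mulrC. Qed.

Lemma merit_nonincreasing t : merit t.+1 <= merit t.
Proof.
rewrite (le_trans (merit_decrease t))// gerBl mulr_ge0 ?dot_ge0//.
exact: ltW kappa_gt0.
Qed.

(** The merit is nonincreasing and bounded below, so its decrements, which control
    the squared [z]-steps, tend to [0]. *)
Lemma z_step_cvg0 : (fun t => z t.+2 - z t.+1) @ \oo --> (0 : 'rV[R]_n).
Proof.
have step_ge0 t : 0 <= dot (z t.+2 - z t.+1) (z t.+2 - z t.+1) by exact: dot_ge0.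
have merit_cvg : cvgn merit.
  apply: nonincreasing_is_cvgn.
    by apply/nonincreasing_seqP => t; exact: merit_nonincreasing.
  have [m mlb] := zeta_bounded; exists m => _ [t _ <-].
  by rewrite (le_trans _ (merit_ge t))// (mlb (f (x t.+1) + g _))//; exists (x t.+1).
apply: dot_cvg0.
have drop0 : ((merit t - merit t.+1) / kappa) @[t --> \oo] --> (0 : R).
  rewrite -[X in _ --> X](mul0r kappa^-1) -(subrr (limn merit)).
  apply: cvgM; last exact: cvg_cst.
  by apply: cvgB => //; rewrite (cvg_shiftS merit).
apply: (squeeze_cvgr _ (cvg_cst 0) drop0); near=> t.
rewrite step_ge0 ler_pdivlMr// mulrC /kappa.
have := merit_decrease t; lra.
Unshelve. all: by end_near. Qed.

Lemma v_step_cvg0 : (fun t => v t.+2 - v t.+1) @ \oo --> (0 : 'rV[R]_n).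
Proof.
apply: (dot_le_cvg0 (C := Lip ^+ 2 / rho ^+ 2)) z_step_cvg0 => t.
rewrite -(ler_pM2l (exprn_gt0 2 rho_gt0)) (le_trans (dual_step_le t))//.
by rewrite mulrA mulrCA divff ?mulr1// expf_neq0// gt_eqF.
Qed.

End ADMM.

(** * Convergence to a stationary point *)

Theorem theorem3 (R : realType) (n : nat) (f g : 'rV[R]_n -> R)
    (sigma Lip rho : R)
    (f_convex : convex f)
    (f_diff : forall x, differentiable f x)
    (zeta_coercive : coercive (f \+ g))
    (zeta_bounded : has_lbound (range (f \+ g)))
    (g_lsc : lower_semicontinuous (EFin \o g))
    (sigma_gt0 : 0 < sigma)
    (g_wconvex : weakly_convex sigma g)
    (g_ddiff : directionally_differentiable g)
    (Lip_gt0 : 0 < Lip)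
    (grad_lip : forall x y : 'rV[R]_n,
      norm2 (grad f x - grad f y) <= Lip * norm2 (x - y))
    (rho_gt : Num.max sigma (Num.sqrt 2 * Lip) < rho)
    (x z v : nat -> 'rV[R]_n)
    (xzv_admm : admm_iterates f g rho x z v) :
  exists (phi : nat -> nat) (xs zs vs : 'rV[R]_n),
    [/\ increasing_seq phi,
        (x (phi k).+1, z (phi k).+1, v (phi k).+1) @[k --> \oo]
          --> (xs, zs, vs)
      & d_stationary (f \+ g) xs].
Proof.
have /andP[sigma_rho Lip_rho] : (sigma < rho) && (Num.sqrt 2 * Lip < rho).
  by rewrite -gt_max.
have rho_gt0 : 0 < rho := lt_trans sigma_gt0 sigma_rho.
have rho_sqr : 2 * Lip ^+ 2 < rho ^+ 2.
  rewrite -[X in X * _](sqr_sqrtr (a := 2))// -exprMn.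
  by rewrite ltr_pXn2r ?nnegrE ?mulr_ge0 ?sqrtr_ge0 ?(ltW Lip_gt0) ?(ltW rho_gt0).
pose mer := merit f g rho x z v.
have mer_le t : mer t <= mer 0%N.
  elim: t => // t; apply: le_trans.
  exact: (merit_nonincreasing xzv_admm f_convex f_diff Lip_gt0 grad_lip).
have [r xr] := zeta_coercive (mer 0%N + 1).
have x_bounded t : `|x t.+2| <= r.
  rewrite (le_trans (norm_le_norm2 _))// leNgt; apply/negP => /ltW/xr.
  have := merit_ge xzv_admm f_diff Lip_gt0 grad_lip rho_gt0 rho_sqr t.+1.
  by have := mer_le t.+1; rewrite /mer /=; lra.
(* The [x]-step involves the previous [z] and [v], and the increments are
   controlled from index [1] on only; so the subsequence starts at index [2]. *)
have [psi psi_incr [xs x_cvg]] := bounded_cvg_subsequence x_bounded.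
have psi_oo := increasing_seq_cvg_infty psi_incr.
have dz0 := z_step_cvg0 xzv_admm f_convex f_diff Lip_gt0 grad_lip rho_gt0 rho_sqr
  zeta_bounded.
have dv0 := v_step_cvg0 xzv_admm f_convex f_diff Lip_gt0 grad_lip rho_gt0 rho_sqr
  zeta_bounded.
have {}dz0 := cvg_comp _ _ psi_oo dz0.
have {}dv0 := cvg_comp _ _ psi_oo dv0.
have z_cvg : z (psi k).+2 @[k --> \oo] --> xs.
  have zE t : z t.+1 = x t.+1 - (v t.+1 - v t).
    by rewrite -(admm_residual xzv_admm) subKr.
  rewrite -[xs]subr0; under eq_fun do rewrite zE.
  exact: cvgB x_cvg dv0.
pose vs := rho^-1 *: grad f xs.
have rho_vs : rho *: vs = grad f xs.
  by rewrite scalerA divff ?scale1r// gt_eqF.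
have v_cvg : v (psi k).+2 @[k --> \oo] --> vs.
  have vE t : v t.+1 = rho^-1 *: grad f (z t.+1).
    rewrite (admm_grad xzv_admm f_diff) scalerA mulVf ?scale1r//.
    by rewrite gt_eqF.
  under eq_fun do rewrite vE.
  by apply: cvgZ; [exact: cvg_cst | exact: (grad_cvg Lip_gt0 grad_lip z_cvg)].
exists (S \o psi), xs, xs, vs; split => [a b||].
- exact: psi_incr.
- exact: (cvg_pair (cvg_pair x_cvg z_cvg) v_cvg).
have z_prev : z (psi k).+1 @[k --> \oo] --> xs.
  rewrite -[xs]subr0; under eq_fun => k do
    rewrite -(subKr (z (psi k).+2) (z (psi k).+1)).
  exact: cvgB z_cvg dz0.
have v_prev : v (psi k).+1 @[k --> \oo] --> vs.
  rewrite -[vs]subr0; under eq_fun => k do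
    rewrite -(subKr (v (psi k).+2) (v (psi k).+1)).
  exact: cvgB v_cvg dv0.
have xs_prox : is_prox rho g (xs - vs) xs.
  apply: (is_prox_closed g_lsc (cvgB z_prev v_prev) x_cvg) => k.
  exact: (admm_x_prox xzv_admm).
move=> y; set d := y - xs.
have g_dir := g_ddiff xs d.
have zeta_dir : dquot (f \+ g) xs d tau @[tau --> 0^'+]
    --> dot (grad f xs) d + dirderiv g xs d.
  have -> : dquot (f \+ g) xs d = dquot f xs d \+ dquot g xs d.
    by apply/funext => tau; rewrite /dquot /= -mulrDl; congr (_ / _); ring.
  by apply: cvgD => //; exact: dquot_cvg_grad.
split; first by apply/cvg_ex; eexists; exact: zeta_dir.
rewrite /dirderiv (cvg_lim _ zeta_dir)//.
have := is_prox_dirderiv_ge xs_prox g_dir.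
rewrite addrAC subrr add0r -dotZl scalerN rho_vs dotNl.
by rewrite /dirderiv; lra.
Qed.
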